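(* Let $S$ be a sub-semifield of $\mathbb{T}$, let $v:K\to S$ be a valuation on a field $K$, and let $\mathcal{M}$ be a toric monoid. Let $I\subseteq K[\mathcal{M}]$ be an ideal and fix $f\in S[\mathcal{M}]$. If there is a pair $(g,h)$ that arises from the missing-monomial construction for $f$ (for some monomial $m$) such that $\operatorname{supp}(g)$ does not contain any circuit of $I$, then the image of $f$ in $S[\mathcal{M}]/\operatorname{Bend}(\operatorname{trop}I)$ is not cancellative.
   Context: $\mathbb{T}$ is the tropical semifield $(\mathbb{R}\cup\{-\infty\},\max,+)$; semirings are commutative and additively idempotent, ordered by $a\le b\iff a+b=b$. A valuation $v:K\to S$ is a map with $v(a)=0_S\iff a=0$, $v(ab)=v(a)v(b)$, $v(1)=1_S$, $v(a+b)\le v(a)+v(b)$. A toric monoid is a monoid $\sigma^\vee\cap M$ for $M$ a finitely generated free abelian group and $\sigma$ a strongly convex rational polyhedral cone in $\operatorname{Hom}(M,\mathbb{Z})\otimes\mathbb{R}$. In $S[\mathcal{M}]$ a monomial is an element $\chi^u$, $u\in\mathcal{M}$, and a term is $a\chi^u$ with $a\in S\setminus\{0\}$; $\operatorname{supp}(f)$ is the set of monomials occurring in $f$ with nonzero coefficient. For $F=\sum_uc_u\chi^u\in K[\mathcal{M}]$, $\operatorname{trop}(F)=\sum_uv(c_u)\chi^u$, and $\operatorname{trop}I$ is the ideal of $S[\mathcal{M}]$ generated by the $\operatorname{trop}(F)$, $F\in I$. The bend relations of $f\in S[\mathcal{M}]$ are the pairs $(f,f_{\hat\imath})$, $i\in\operatorname{supp}(f)$,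 where $f_{\hat\imath}$ is $f$ with the $i$ term deleted; $\operatorname{Bend}(J)$ is the congruence generated by the bend relations of all elements of $J$. An element $s$ of a semiring is cancellative if $s\neq0$ and $sb=sc$ implies $b=c$. A circuit of $I$ is the support (a set of monomials) of a nonzero element of $I$ whose support is minimal under inclusion among supports of nonzero elements of $I$. Missing-monomial construction for $f$: fix a monomial $m$ and let $f_1,\dots,f_k$ be the terms of $f$, so $f=\sum_{i=1}^kf_i$. Suppose for each $i$ there are $j_i\neq i$ and a term $h_i$ such that $mf_i\le f_{j_i}h_i$; choose such. Then put $h=\sum_{i=1}^kh_i$ and $g=h+m$. The output is the pair $(g,h)$; one says that $(g,h)$ arises from the construction for $f$ and $m$. *)

(* Defs.v *)
From HB Require Import structures.
From mathcomp Require Import all_boot all_order all_algebra generic_quotient.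
From mathcomp Require Import finmap boolp classical_sets reals.

Set Implicit Arguments.
Unset Strict Implicit.
Unset Printing Implicit Defensive.

Import Order.TTheory GRing.Theory Num.Theory.
Local Open Scope quotient_scope.
Local Open Scope ring_scope.

(* The tropical semifield: [tbot] is -oo, the zero of the semiring, and       *)
(* [tfin 0] is its one.                                                       *)
Inductive tropical (R : realType) := tbot | tfin of R.
Arguments tbot {R}.

Section Tropical.
Context {R : realType}.
Implicit Types x y : tropical R.

Definition tropical_to_option x := if x is tfin a then Some a else None.
Definition option_to_tropical (o : option R) : tropical R :=
  if o is Some a then tfin a else tbot.

Fact tropical_to_optionK : cancel tropical_to_option option_to_tropical.
Proof. by case. Qed.

HB.instance Definition _ :=
  Choice.copy (tropical R) (can_type tropical_to_optionK).

Definition tadd x y :=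
  match x, y with
  | tbot, _ => y
  | _, tbot => x
  | tfin a, tfin b => tfin (Num.max a b)
  end.

Definition tmul x y :=
  match x, y with
  | tfin a, tfin b => tfin (a + b)
  | _, _ => tbot
  end.

Fact taddA : associative tadd.
Proof. by move=> [|a] [|b] [|c] //=; rewrite maxA. Qed.

Fact taddC : commutative tadd.
Proof. by move=> [|a] [|b] //=; rewrite maxC. Qed.

Fact tadd0 : left_id tbot tadd.
Proof. by case. Qed.

HB.instance Definition _ :=
  GRing.isNmodule.Build (tropical R) taddA taddC tadd0.

Fact tmulA : associative tmul.
Proof. by move=> [|a] [|b] [|c] //=; rewrite addrA. Qed.

Fact tmulC : commutative tmul.
Proof. by move=> [|a] [|b] //=; rewrite addrC. Qed.

Fact tmul1 : left_id (tfin 0) tmul.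
Proof. by move=> [|a] //=; rewrite add0r. Qed.

Fact tmulD : left_distributive tmul tadd.
Proof. by move=> [|a] [|b] [|c] //=; rewrite addr_maxl. Qed.

Fact tmul0 : left_zero tbot tmul.
Proof. by []. Qed.

Fact tone_neq0 : tfin 0 != tbot :> tropical R.
Proof. by []. Qed.

HB.instance Definition _ := GRing.Nmodule_isComNzSemiRing.Build (tropical R)
  tmulA tmulC tmul1 tmulD tmul0 tone_neq0.

End Tropical.

Section SubSemiring.
Context {A : comNzSemiRingType}.

Record subsemiring (S : semiringClosed A) :=
  SubSemiring { subsemiring_val : A; _ : subsemiring_val \in S }.

Variable S : semiringClosed A.

HB.instance Definition _ := [isSub for @subsemiring_val S].
HB.instance Definition _ := [Choice of subsemiring S by <:].
HB.instance Definition _ :=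
  [SubChoice_isSubComNzSemiRing of subsemiring S by <:].

End SubSemiring.

Definition semifield (A : comNzSemiRingType) : Prop :=
  forall a : A, a != 0 -> exists b : A, a * b = 1.

(* The canonical order; it is meant for additively idempotent semirings.      *)
Definition ile (A : nmodType) (a b : A) : Prop := a + b = b.

Definition valuation (K : fieldType) (A : comNzSemiRingType) (v : K -> A) :
    Prop :=
  [/\ forall a, v a = 0 <-> a = 0,
      forall a b, v (a * b) = v a * v b,
      v 1 = 1 &
      forall a b, ile (v (a + b)) (v a + v b)].

Definition cancellative (A : pzSemiRingType) (s : A) : Prop :=
  s <> 0 /\ GRing.lreg s.

(* ideals need not be proper *)
Definition ideal (A : comPzSemiRingType) (J : set A) : Prop :=
  [/\ J 0, forall x y, J x -> J y -> J (x + y)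
    & forall a x, J x -> J (a * x)].

Definition ideal_generated (A : comPzSemiRingType) (P : set A) : set A :=
  [set x | forall J, ideal J -> (P `<=` J)%classic -> J x]%classic.

Section Congruence.
Context {A : comPzSemiRingType}.

Record is_congruence (E : A -> A -> Prop) : Prop := IsCongruence {
  congr_refl : forall x, E x x;
  congr_sym : forall x y, E x y -> E y x;
  congr_trans : forall x y z, E x y -> E y z -> E x z;
  congr_add : forall x x' y y', E x x' -> E y y' -> E (x + y) (x' + y');
  congr_mul : forall x x' y y', E x x' -> E y y' -> E (x * y) (x' * y') }.

Record congruence := Congruence {
  congr_rel :> A -> A -> Prop;
  congruenceP : is_congruence congr_rel }.

Definition congr_gen_rel (P : A -> A -> Prop) (x y : A) : Prop :=
  forall E, is_congruence E -> (forall a b, P a b -> E a b) -> E x y.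

Fact congr_gen_subproof P : is_congruence (congr_gen_rel P).
Proof.
split.
- by move=> x E cE _; apply: congr_refl.
- by move=> x y xy E cE sPE; apply: congr_sym => //; apply: xy.
- move=> x y z xy yz E cE sPE.
  by apply: (congr_trans cE (y := y)); [apply: xy | apply: yz].
- move=> x x' y y' xx yy E cE sPE.
  by apply: congr_add => //; [apply: xx | apply: yy].
- move=> x x' y y' xx yy E cE sPE.
  by apply: congr_mul => //; [apply: xx | apply: yy].
Qed.

Definition congr_gen P : congruence := Congruence (congr_gen_subproof P).

Variable E : congruence.

Definition congr_bool (x y : A) : bool := `[< E x y >].

Fact congr_bool_equiv : equiv_class_of congr_bool.
Proof.
have cE := congruenceP E; split.
- by move=> x; apply/asboolP; apply: congr_refl.
- by move=> x y; apply/asboolP/asboolP; apply: congr_sym.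
- move=> y x z /asboolP xy /asboolP yz; apply/asboolP.
  exact: (congr_trans cE xy yz).
Qed.

Canonical congr_equiv := EquivRelPack congr_bool_equiv.
Canonical congr_encModRel := defaultEncModRel congr_bool.

Definition cquot := {eq_quot congr_bool}%qT.

HB.instance Definition _ : EqQuotient A congr_bool cquot := EqQuotient.on cquot.
HB.instance Definition _ := Choice.on cquot.

Definition cquot_zero : cquot := lift_cst cquot 0.
Definition cquot_one : cquot := lift_cst cquot 1.
Definition cquot_add := lift_op2 cquot +%R.
Definition cquot_mul := lift_op2 cquot *%R.

Canonical pi_cquot_zero := PiConst cquot_zero.
Canonical pi_cquot_one := PiConst cquot_one.

Lemma cquotP (x y : A) : reflect (\pi_cquot x = \pi_cquot y) `[< E x y >].
Proof. by apply: (iffP idP) => [?|/eqmodP //]; apply/eqmodP. Qed.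

Lemma congr_repr (x : A) : E (repr (\pi_cquot x)) x.
Proof. by apply/asboolP/cquotP; rewrite reprK. Qed.

Fact pi_cquot_add : {morph \pi_cquot : x y / x + y >-> cquot_add x y}.
Proof.
move=> x y; unlock cquot_add; apply/esym/cquotP/asboolP.
by apply: (congr_add (congruenceP E)); apply: congr_repr.
Qed.
Canonical pi_cquot_add_morph := PiMorph2 pi_cquot_add.

Fact pi_cquot_mul : {morph \pi_cquot : x y / x * y >-> cquot_mul x y}.
Proof.
move=> x y; unlock cquot_mul; apply/esym/cquotP/asboolP.
by apply: (congr_mul (congruenceP E)); apply: congr_repr.
Qed.
Canonical pi_cquot_mul_morph := PiMorph2 pi_cquot_mul.

Fact cquot_addA : associative cquot_add.
Proof. by move=> x y z; rewrite -[x]reprK -[y]reprK -[z]reprK !piE addrA. Qed.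

Fact cquot_addC : commutative cquot_add.
Proof. by move=> x y; rewrite -[x]reprK -[y]reprK !piE addrC. Qed.

Fact cquot_add0 : left_id cquot_zero cquot_add.
Proof. by move=> x; rewrite -[x]reprK !piE add0r. Qed.

HB.instance Definition _ :=
  GRing.isNmodule.Build cquot cquot_addA cquot_addC cquot_add0.

Fact cquot_mulA : associative cquot_mul.
Proof. by move=> x y z; rewrite -[x]reprK -[y]reprK -[z]reprK !piE mulrA. Qed.

Fact cquot_mulC : commutative cquot_mul.
Proof. by move=> x y; rewrite -[x]reprK -[y]reprK !piE mulrC. Qed.

Fact cquot_mul1 : left_id cquot_one cquot_mul.
Proof. by move=> x; rewrite -[x]reprK !piE mul1r. Qed.

Fact cquot_mulD : left_distributive cquot_mul cquot_add.
Proof. by move=> x y z; rewrite -[x]reprK -[y]reprK -[z]reprK !piE mulrDl. Qed.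

Fact cquot_mul0 : left_zero cquot_zero cquot_mul.
Proof. by move=> x; rewrite -[x]reprK !piE mul0r. Qed.

HB.instance Definition _ := GRing.Nmodule_isComPzSemiRing.Build cquot
  cquot_mulA cquot_mulC cquot_mul1 cquot_mulD cquot_mul0.

End Congruence.

Arguments cquot {A} E.

(* The monoid semiring A[M] of a commutative monoid M, written additively:    *)
(* [f u] is the coefficient of chi^u in f and [finsupp f] is the support of   *)
(* f, the monomial chi^u being identified with its exponent u.                *)
Definition monoid_algebra (A : nmodType) (M : choiceType) :=
  {fsfun M -> A with 0}.

HB.instance Definition _ (A : nmodType) (M : choiceType) :=
  Choice.on (monoid_algebra A M).

Definition mterm (A : nmodType) (M : choiceType) (a : A) (u : M) :
    monoid_algebra A M :=
  [fsfun x in [fset u]%fset => a].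

Section MonoidAlgebraNmodule.
Context {A : nmodType} {M : choiceType}.
Implicit Types f g : monoid_algebra A M.

Definition ma_zero : monoid_algebra A M := [fsfun].
Definition ma_add f g : monoid_algebra A M :=
  [fsfun u in (finsupp f `|` finsupp g)%fset => f u + g u].

Lemma ma_zeroE u : ma_zero u = 0.
Proof. by rewrite fsfunE. Qed.

Lemma ma_addE f g u : ma_add f g u = f u + g u.
Proof.
rewrite fsfunE inE; case: finsuppP => [_|//]; case: finsuppP => // _.
by rewrite addr0.
Qed.

Lemma mtermE (a : A) (u x : M) : mterm a u x = if x == u then a else 0.
Proof. by rewrite fsfunE inE. Qed.

Fact ma_addA : associative ma_add.
Proof. by move=> f g h; apply/fsfunP => u; rewrite !ma_addE addrA. Qed.

Fact ma_addC : commutative ma_add.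
Proof. by move=> f g; apply/fsfunP => u; rewrite !ma_addE addrC. Qed.

Fact ma_add0 : left_id ma_zero ma_add.
Proof. by move=> f; apply/fsfunP => u; rewrite ma_addE ma_zeroE add0r. Qed.

HB.instance Definition _ :=
  GRing.isNmodule.Build (monoid_algebra A M) ma_addA ma_addC ma_add0.

Lemma coef0 (u : M) : (0 : monoid_algebra A M) u = 0.
Proof. exact: ma_zeroE. Qed.

Lemma coefD f g u : (f + g) u = f u + g u.
Proof. exact: ma_addE. Qed.

Lemma coef_sum (I : Type) (r : seq I) (P : pred I)
    (F : I -> monoid_algebra A M) u :
  (\sum_(i <- r | P i) F i) u = \sum_(i <- r | P i) F i u.
Proof.
exact: (big_morph (fun f : monoid_algebra A M => f u)
  (fun f g => coefD f g u) (coef0 u)).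
Qed.

Lemma mterm0 (u : M) : mterm 0 u = 0 :> monoid_algebra A M.
Proof. by apply/fsfunP => x; rewrite mtermE coef0 if_same. Qed.

Lemma mtermD (a b : A) (u : M) : mterm (a + b) u = mterm a u + mterm b u.
Proof.
by apply/fsfunP => x; rewrite coefD !mtermE; case: ifP; rewrite ?addr0.
Qed.

Lemma mterm_sumE f : f = \sum_(u <- finsupp f) mterm (f u) u.
Proof.
apply/fsfunP => x; rewrite coef_sum.
case: finsuppP => [xf|xf].
  rewrite big1_seq // => u /andP[_ uf]; rewrite mtermE; case: eqP => // xu.
  by rewrite xu uf in xf.
rewrite (big_fsetD1 x) //= mtermE eqxx big1_seq ?addr0 // => u.
by rewrite !inE mtermE eq_sym => /andP[_ /andP[/negPf -> _]].
Qed.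

End MonoidAlgebraNmodule.

Section MonoidAlgebraZmodule.
Context {A : zmodType} {M : choiceType}.
Implicit Types f : monoid_algebra A M.

Definition ma_opp f : monoid_algebra A M := [fsfun u in finsupp f => - f u].

Fact ma_addN : left_inverse 0 ma_opp +%R.
Proof.
move=> f; apply/fsfunP => u; rewrite coefD coef0 fsfunE.
by case: finsuppP => _; rewrite ?addr0 ?addNr.
Qed.

HB.instance Definition _ :=
  GRing.Nmodule_isZmodule.Build (monoid_algebra A M) ma_addN.

End MonoidAlgebraZmodule.

Section MonoidAlgebraSemiRing.
Context {A : comNzSemiRingType} {M : nmodType}.
Implicit Types f g h : monoid_algebra A M.

Definition ma_one : monoid_algebra A M := mterm 1 0.
Definition ma_mul f g : monoid_algebra A M :=
  \sum_(u <- finsupp f) \sum_(w <- finsupp g) mterm (f u * g w) (u + w).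

Lemma ma_mul_widen (U W : {fset M}) f g :
  (finsupp f `<=` U)%fset -> (finsupp g `<=` W)%fset ->
  ma_mul f g = \sum_(u <- U) \sum_(w <- W) mterm (f u * g w) (u + w).
Proof.
move=> fU gW; rewrite /ma_mul (big_fset_incl _ fU); last first.
  by move=> u _ uf; rewrite big1 // => w _; rewrite fsfun_dflt // mul0r mterm0.
apply: eq_bigr => u _; rewrite (big_fset_incl _ gW) // => w _ wg.
by rewrite (fsfun_dflt wg) mulr0 mterm0.
Qed.

Lemma ma_mul_mterm (a b : A) (u w : M) :
  ma_mul (mterm a u) (mterm b w) = mterm (a * b) (u + w).
Proof.
rewrite (@ma_mul_widen [fset u]%fset [fset w]%fset) ?finsupp_sub //.
by rewrite !big_seq_fset1 !mtermE !eqxx.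
Qed.

Fact ma_mulC : commutative ma_mul.
Proof.
move=> f g; rewrite /ma_mul exchange_big; apply: eq_bigr => w _.
by apply: eq_bigr => u _; rewrite mulrC addrC.
Qed.

Fact ma_mul0 : left_zero 0 ma_mul.
Proof.
move=> f; rewrite /ma_mul big1 // => u _; rewrite big1 // => w _.
by rewrite coef0 mul0r mterm0.
Qed.

Fact ma_mulD : left_distributive ma_mul +%R.
Proof.
move=> f g h; pose U := (finsupp f `|` finsupp g `|` finsupp (f + g)%R)%fset.
have fU : (finsupp f `<=` U)%fset by apply/fsubsetP => x; rewrite !inE => ->.
have gU : (finsupp g `<=` U)%fset.
  by apply/fsubsetP => x; rewrite !inE => ->; rewrite orbT.
have fgU : (finsupp (f + g)%R `<=` U)%fset.
  by apply/fsubsetP => x xfg; apply/fsetUP; right.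
rewrite (ma_mul_widen fgU (fsubset_refl _)) (ma_mul_widen fU (fsubset_refl _)).
rewrite (ma_mul_widen gU (fsubset_refl _)) -big_split; apply: eq_bigr => u _.
rewrite -big_split; apply: eq_bigr => w _.
by rewrite coefD mulrDl mtermD.
Qed.

Lemma ma_mul_suml (I : Type) (r : seq I) (F : I -> monoid_algebra A M) g :
  ma_mul (\sum_(i <- r) F i) g = \sum_(i <- r) ma_mul (F i) g.
Proof.
exact: (big_morph (ma_mul^~ g) (fun x y => ma_mulD x y g) (ma_mul0 g)).
Qed.

Lemma ma_mul_sumr (I : Type) (r : seq I) (F : I -> monoid_algebra A M) f :
  ma_mul f (\sum_(i <- r) F i) = \sum_(i <- r) ma_mul f (F i).
Proof.
by rewrite ma_mulC ma_mul_suml; apply: eq_bigr => i _; rewrite ma_mulC.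
Qed.

Fact ma_mulA : associative ma_mul.
Proof.
move=> f g h; rewrite (mterm_sumE f) !ma_mul_suml; apply: eq_bigr => u _.
rewrite (mterm_sumE g) ma_mul_suml !ma_mul_sumr ma_mul_suml.
apply: eq_bigr => w _; rewrite (mterm_sumE h) !ma_mul_sumr.
by apply: eq_bigr => x _; rewrite !ma_mul_mterm mulrA addrA.
Qed.

Fact ma_mul1 : left_id ma_one ma_mul.
Proof.
move=> f; rewrite {1}(mterm_sumE f) ma_mul_sumr [RHS]mterm_sumE.
by apply: eq_bigr => u _; rewrite ma_mul_mterm mul1r add0r.
Qed.

Fact ma_one_neq0 : ma_one != 0.
Proof.
apply/eqP => /fsfunP /(_ 0); rewrite coef0 mtermE eqxx.
by apply/eqP; rewrite oner_neq0.
Qed.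

HB.instance Definition _ :=
  GRing.Nmodule_isComNzSemiRing.Build (monoid_algebra A M)
    ma_mulA ma_mulC ma_mul1 ma_mulD ma_mul0 ma_one_neq0.

End MonoidAlgebraSemiRing.

HB.instance Definition _ (A : comNzRingType) (M : nmodType) :=
  GRing.Zmodule.on (monoid_algebra A M).

Section ToricMonoid.
Context {R : realType}.

Definition fg_free_abelian (M : zmodType) : Prop :=
  exists (n : nat) (e : 'I_n -> M),
    bijective (fun c : {ffun 'I_n -> int} => \sum_i e i *~ c i).

Variable M : zmodType.

(* For M free and finitely generated, Hom(M, Z) (x) R is identified with the  *)
(* group of additive maps M -> R.                                             *)
Definition rational_polyhedral_cone (sigma : set {additive M -> R}) : Prop :=
  exists (k : nat) (w : 'I_k -> {additive M -> int}),
    forall x, sigma x <->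
      exists2 c : 'I_k -> R, (forall i, 0 <= c i) &
        forall u, x u = \sum_i c i * (w i u)%:~R.

Definition strongly_convex (sigma : set {additive M -> R}) : Prop :=
  forall x y : {additive M -> R}, sigma x -> sigma y ->
    (forall u, y u = - x u) -> forall u, x u = 0.

Definition dual_cone (sigma : set {additive M -> R}) : {pred M} :=
  fun u => `[< forall x, sigma x -> 0 <= x u >].

Variable sigma : set {additive M -> R}.

Fact dual_cone_closed : GRing.nmod_closed (dual_cone sigma).
Proof.
split; first by apply/asboolP => x _; rewrite raddf0.
move=> u w /asboolP su /asboolP sw; apply/asboolP => x sx.
by rewrite raddfD addr_ge0 ?su ?sw.
Qed.

Record toric_monoid :=
  ToricMonoid { toric_val : M; _ : toric_val \in dual_cone sigma }.

HB.instance Definition _ := [isSub for toric_val].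
HB.instance Definition _ := [Choice of toric_monoid by <:].
HB.instance Definition _ :=
  GRing.SubChoice_isSubNmodule.Build M _ toric_monoid dual_cone_closed.

End ToricMonoid.

Definition monomial (A : comNzSemiRingType) (M : choiceType) (u : M) :
    monoid_algebra A M :=
  mterm 1 u.

Definition is_term (A : nmodType) (M : choiceType) (t : monoid_algebra A M) :
    Prop :=
  exists a u, a != 0 /\ t = mterm a u.

Section Bend.
Context {A : comNzSemiRingType} {M : nmodType}.

Definition delete_term (f : monoid_algebra A M) (i : M) : monoid_algebra A M :=
  [fsfun u in (finsupp f `\ i)%fset => f u].

Definition bend_relation (J : set (monoid_algebra A M))
    (a b : monoid_algebra A M) : Prop :=
  exists f i, [/\ J f, i \in finsupp f, a = f & b = delete_term f i].

Definition bend (J : set (monoid_algebra A M)) :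
    @congruence (monoid_algebra A M) :=
  congr_gen (bend_relation J).

Context {K : fieldType}.

Definition trop (v : K -> A) (F : monoid_algebra K M) : monoid_algebra A M :=
  [fsfun u in finsupp F => v (F u)].

Definition trop_ideal (v : K -> A) (I : set (monoid_algebra K M)) :
    set (monoid_algebra A M) :=
  ideal_generated [set trop v F | F in I]%classic.

Definition circuit (I : set (monoid_algebra K M)) (C : {fset M}) : Prop :=
  exists F, [/\ I F, F <> 0, C = finsupp F
    & forall G, I G -> G <> 0 -> (finsupp G `<=` finsupp F)%fset ->
        finsupp G = finsupp F].

(* The terms of f are indexed by its support, f_u being [mterm (f u) u].      *)
Definition missing_monomial (f : monoid_algebra A M) (m : M)
    (g h : monoid_algebra A M) : Prop :=
  exists (j : M -> M) (t : M -> monoid_algebra A M),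
    [/\ forall u, u \in finsupp f ->
          [/\ j u \in finsupp f, j u <> u, is_term (t u)
            & ile (monomial A m * mterm (f u) u)
                  (mterm (f (j u)) (j u) * t u)],
        h = \sum_(u <- finsupp f) t u
      & g = h + monomial A m].

End Bend.

(* Main.v *)
Require Import Defs.
From HB Require Import structures.
From mathcomp Require Import all_boot all_order all_algebra generic_quotient.
From mathcomp Require Import finmap boolp classical_sets reals.

Set Implicit Arguments.
Unset Strict Implicit.
Unset Printing Implicit Defensive.

Import Order.TTheory GRing.Theory Num.Theory.
Local Open Scope quotient_scope.
Local Open Scope ring_scope.

(** In the quotient semiring the images of [g] and [h] have the same product
    with that of [f]: since [m f_i <= f_(j_i) h_i], all of [m f] lies below
    [f h], and [f g = f h + m f = f h] already in S[M].  It remains to see that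
    [g] and [h] are not identified by the bend relations of [trop I].

    Identifications are refuted by linear duality.  Let [l] assign to each
    monomial an element of K so that the extension of [l] to a linear form on
    K[M] kills I.  For [F] in I the sum of the [F_u l_u] is zero, so each of its
    terms is minus the sum of the others, and applying the valuation gives
    [v(F_i) v(l_i) <= \sum_(u != i) v(F_u) v(l_u)].  Thus the S-linear form
    [a |-> \sum_u a_u v(l_u)] takes the same value on [trop F] and on [trop F]
    with its [i]-th term deleted.  As I is an ideal, the set of these [l] is
    stable under translation by monomials, so that the relation of having the
    same values under all such forms is compatible with products; it is a
    congruence which contains the bend congruence of [trop I]
    ([bend_pairing]).

    The monomial [m] does not occur in [h], because [m f_i] and [f_(j_i) h_i]
    share a monomial, [j_i <> i], and toric monoids are cancellative
    ([missing_monomial_coef]).  Since supp [g] contains no circuit, its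
    monomials are linearly independent modulo I, and there is a linear form
    that kills I and supp [h] and takes the value 1 at [m]
    ([exists_annihilator]).  The associated S-linear form has value 1 at [g]
    and 0 at [h]. *)

(** * Linear forms vanishing on a subspace *)

(** A subspace that is maximal among those containing [W] and avoiding [x] is a
    hyperplane complementary to the line of [x], and [L y] is the coordinate of
    [y] along [x]. *)
Lemma scalar_separation (K : fieldType) (V : lmodType K) (W : set V) (x : V) :
  W 0 -> (forall c y z, W y -> W z -> W (c *: y + z)) -> ~ W x ->
  exists L : V -> K, [/\ scalar L, L x = 1 & forall y, W y -> L y = 0].
Proof.
move=> W0 Wlin Wx.
pose subspace (U : set V) :=
  U 0 /\ forall c y z, U y -> U z -> U (c *: y + z).
(* The union with [W] makes the empty chain admissible. *)
pose admissible (X : set V) := subspace (X `|` W)%classic /\ ~ X x.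
have [|X [[[_ Ulin] Xx] Xmax]] := @Zorn_bigcup V admissible.
  move=> C Cadm Ctot; split; last by move=> [X CX]; case: (Cadm _ CX).
  split; first by right.
  move=> c y z [[Y CY Yy]|Wy] [[Z CZ Zz]|Wz].
  - have [YZ|ZY] := Ctot _ _ CY CZ.
      have [[_ Zlin] _] := Cadm _ CZ.
      have [|||] := Zlin c y z; [by left; apply: YZ|by left| |by right].
      by move=> ?; left; exists Z.
    have [[_ Ylin] _] := Cadm _ CY.
    have [|||] := Ylin c y z; [by left|by left; apply: ZY| |by right].
    by move=> ?; left; exists Y.
  - have [[_ Ylin] _] := Cadm _ CY.
    have [|||] := Ylin c y z; [by left|by right| |by right].
    by move=> ?; left; exists Y.
  - have [[_ Zlin] _] := Cadm _ CZ.
    have [|||] := Zlin c y z; [by right|by left| |by right].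
    by move=> ?; left; exists Z.
  - by right; apply: Wlin.
set U := (X `|` W)%classic in Ulin.
have U0 : U 0 by right.
have UZ c y : U y -> U (c *: y).
  by move=> Uy; rewrite -[_ *: _]addr0; apply: Ulin.
have UD y z : U y -> U z -> U (y + z).
  by move=> Uy Uz; rewrite -[y]scale1r; apply: Ulin.
have Ux : ~ U x by case.
have Umul c : U (c *: x) -> c = 0.
  move=> Ucx; apply: contrapT => /eqP c0; apply: Ux.
  by rewrite -[x]scale1r -(mulVf c0) -scalerA; apply: UZ.
(* Otherwise [U + K y] would be a larger subspace, still avoiding [x]. *)
have decomp y : exists c, U (y - c *: x).
  apply: contrapT => nc.
  pose Y : set V := [set z | exists c u, U u /\ z = c *: y + u]%classic.
  have UY u : U u -> Y u by move=> Uu; exists 0, u; rewrite scale0r add0r.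
  have Yy : Y y by exists 1, 0; rewrite scale1r addr0.
  apply: (Xmax Y).
    split; first by move=> u Xu; apply: UY; left.
    move=> YX; apply: nc; exists 0; rewrite scale0r subr0.
    by left; apply: YX.
  split.
    have YW : forall z, (Y `|` W)%classic z -> Y z.
      by move=> z [//|Wz]; apply: UY; right.
    split; first by right.
    move=> c _ _ /YW[a [u [Uu ->]]] /YW[b [w [Uw ->]]]; left.
    exists (c * a + b), (c *: u + w); split; first exact: Ulin.
    by rewrite scalerDr scalerA scalerDl addrACA.
  move=> [c [u [Uu xE]]].
  have [c0|c0] := eqVneq c 0.
    by apply: Ux; rewrite xE c0 scale0r add0r.
  apply: nc; exists c^-1.
  have -> : y - c^-1 *: x = - c^-1 *: u.
    rewrite xE scalerDr scalerA mulVf // scale1r opprD addrA subrr add0r.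
    by rewrite scaleNr.
  exact: UZ.
have [L UL] := choice decomp.
have Leq c y : U (y - c *: x) -> L y = c.
  move=> Uc; apply/eqP; rewrite -subr_eq0; apply/eqP/Umul.
  have -> : (L y - c) *: x = (y - c *: x) + (- 1) *: (y - L y *: x).
    by rewrite scaleN1r opprB [RHS]addrC addrA subrK scalerBl.
  by apply: UD => //; apply: UZ.
exists L; split.
- move=> c y z; apply: Leq.
  have -> : c *: y + z - (c * L y + L z) *: x
          = c *: (y - L y *: x) + (z - L z *: x).
    by rewrite scalerDl scalerBr scalerA opprD addrACA.
  exact: Ulin.
- by apply: Leq; rewrite scale1r subrr.
- by move=> y Wy; apply: Leq; rewrite scale0r subr0; right.
Qed.

(** * Coefficients in monoid algebras *)

Lemma mulr_mterm (A : comNzSemiRingType) (M : nmodType) (c d : A) (x u : M) :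
  mterm c x * mterm d u = mterm (c * d) (x + u) :> monoid_algebra A M.
Proof. exact: ma_mul_mterm. Qed.

Section MonoidAlgebraScale.
Context {A : comNzRingType} {M : nmodType}.
Implicit Types F G : monoid_algebra A M.

(** Scaling as multiplication by a constant, so that ideals are visibly
    subspaces. *)
Definition ma_scale (c : A) F : monoid_algebra A M := mterm c 0 * F.

Fact ma_scaleA a b F : ma_scale a (ma_scale b F) = ma_scale (a * b) F.
Proof. by rewrite /ma_scale mulrA mulr_mterm addr0. Qed.

Fact ma_scale1 : left_id 1 ma_scale.
Proof. by move=> F; apply: (mul1r F). Qed.

Fact ma_scaleDr : right_distributive ma_scale +%R.
Proof. by move=> a F G; rewrite /ma_scale mulrDr. Qed.

Fact ma_scaleDl F : {morph ma_scale^~ F : a b / a + b}.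
Proof. by move=> a b; rewrite /ma_scale mtermD mulrDl. Qed.

HB.instance Definition _ := GRing.Zmodule_isLmodule.Build A
  (monoid_algebra A M) ma_scaleA ma_scale1 ma_scaleDr ma_scaleDl.

Lemma ma_scaleE c F : c *: F = mterm c 0 * F.
Proof. by []. Qed.

Lemma coefZ c F u : (c *: F) u = c * F u.
Proof.
rewrite ma_scaleE [in LHS](mterm_sumE F) mulr_sumr Defs.coef_sum.
rewrite [in RHS](mterm_sumE F) Defs.coef_sum mulr_sumr; apply: eq_bigr => w _.
by rewrite mulr_mterm add0r !mtermE; case: eqP; rewrite ?mulr0.
Qed.

End MonoidAlgebraScale.

Section Pairing.
Context {A : comNzSemiRingType}.

(** The value at [a] of the linear form given by [w] on the monomials. *)
Definition pairing {M : choiceType} (a : monoid_algebra A M) (w : M -> A) : A :=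
  \sum_(u <- finsupp a) a u * w u.

Lemma pairing_widen {M : choiceType} {U : {fset M}} {a : monoid_algebra A M} w :
  (finsupp a `<=` U)%fset -> pairing a w = \sum_(u <- U) a u * w u.
Proof.
move=> aU; rewrite /pairing (big_fset_incl _ aU) // => u _ ua.
by rewrite fsfun_dflt // mul0r.
Qed.

Lemma pairingD {M : choiceType} (a b : monoid_algebra A M) w :
  pairing (a + b) w = pairing a w + pairing b w.
Proof.
pose U := (finsupp a `|` finsupp b `|` finsupp (a + b)%R)%fset.
have aU : (finsupp a `<=` U)%fset by apply/fsubsetP => u; rewrite !inE => ->.
have bU : (finsupp b `<=` U)%fset.
  by apply/fsubsetP => u; rewrite !inE => ->; rewrite orbT.
have abU : (finsupp (a + b)%R `<=` U)%fset.
  by apply/fsubsetP => u uab; apply/fsetUP; right.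
rewrite (pairing_widen w aU) (pairing_widen w bU) (pairing_widen w abU).
by rewrite -big_split; apply: eq_bigr => u _; rewrite Defs.coefD mulrDl.
Qed.

Lemma pairing0 {M : choiceType} w : pairing (0 : monoid_algebra A M) w = 0.
Proof. by rewrite /pairing big1 // => u _; rewrite Defs.coef0 mul0r. Qed.

Lemma pairing_sum {M : choiceType} {T : Type} (r : seq T)
    (a : T -> monoid_algebra A M) w :
  pairing (\sum_(i <- r) a i) w = \sum_(i <- r) pairing (a i) w.
Proof.
exact: (big_morph (fun a : monoid_algebra A M => pairing a w)
  (fun a b => pairingD a b w) (pairing0 w)).
Qed.

Lemma pairing_mterm {M : choiceType} c (u : M) w :
  pairing (mterm c u) w = c * w u.
Proof.
rewrite (@pairing_widen _ [fset u]%fset) ?finsupp_sub //.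
by rewrite big_seq_fset1 mtermE eqxx.
Qed.

Lemma pairing_shift {M : nmodType} (c : A) (x : M) (a : monoid_algebra A M) w :
  pairing (mterm c x * a) w = c * pairing a (fun u => w (x + u)).
Proof.
rewrite {1}[a]mterm_sumE mulr_sumr pairing_sum [in RHS]/pairing mulr_sumr.
by apply: eq_bigr => u _; rewrite mulr_mterm pairing_mterm mulrA.
Qed.

Lemma delete_termE {M : nmodType} (a : monoid_algebra A M) (i x : M) :
  delete_term a i x = if x == i then 0 else a x.
Proof.
rewrite fsfunE !inE; case: (x == i) => //=.
by case: finsuppP => // _.
Qed.

Lemma delete_termK {M : nmodType} (a : monoid_algebra A M) (i : M) :
  mterm (a i) i + delete_term a i = a.
Proof.
apply/fsfunP => x; rewrite Defs.coefD mtermE delete_termE.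
by case: eqP => [->|_]; rewrite ?addr0 ?add0r.
Qed.

Lemma delete_termD {M : nmodType} (a b : monoid_algebra A M) (i : M) :
  delete_term (a + b) i = delete_term a i + delete_term b i.
Proof.
apply/fsfunP => x; rewrite !(Defs.coefD, delete_termE).
by case: eqP; rewrite ?addr0.
Qed.

Lemma coef_shift {M : nmodType} (addrI_M : right_injective (@GRing.add M))
    (c : A) (x u : M) (a : monoid_algebra A M) :
  (mterm c x * a) (x + u) = c * a u.
Proof.
rewrite [in LHS](mterm_sumE a) mulr_sumr Defs.coef_sum [in RHS](mterm_sumE a).
rewrite Defs.coef_sum mulr_sumr; apply: eq_bigr => w _.
rewrite mulr_mterm !mtermE (inj_eq (@addrI_M x)).
by case: eqP; rewrite ?mulr0.
Qed.

Lemma delete_term_shift {M : nmodType}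
    (addrI_M : right_injective (@GRing.add M))
    (c : A) (x u : M) (a : monoid_algebra A M) :
  delete_term (mterm c x * a) (x + u) = mterm c x * delete_term a u.
Proof.
rewrite -{1}(delete_termK a u) mulrDr delete_termD mulr_mterm.
have -> : delete_term (mterm (c * a u) (x + u)) (x + u) = 0.
  by apply/fsfunP => y; rewrite delete_termE mtermE Defs.coef0; case: eqP.
rewrite add0r; apply/fsfunP => y; rewrite delete_termE; case: eqP => // ->.
by rewrite coef_shift // delete_termE eqxx mulr0.
Qed.

End Pairing.

(** * The canonical order *)

Section Order.
Context {A : nmodType}.
Implicit Types a b c d : A.

Lemma ile_trans a b c : ile a b -> ile b c -> ile a c.
Proof. by rewrite /ile => ab bc; rewrite -bc addrA ab. Qed.

Lemma ile_add a b c d : ile a b -> ile c d -> ile (a + c) (b + d).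
Proof. by rewrite /ile => ab cd; rewrite addrACA ab cd. Qed.

Lemma ile_sum (T : eqType) (r : seq T) (a b : T -> A) :
  (forall i, i \in r -> ile (a i) (b i)) ->
  ile (\sum_(i <- r) a i) (\sum_(i <- r) b i).
Proof.
move=> ab; rewrite big_seq [X in ile _ X]big_seq.
apply: (big_ind2 (fun x y => ile x y)) => //; first exact: addr0.
by move=> x y z t; apply: ile_add.
Qed.

End Order.

Lemma ile_mull (A : pzSemiRingType) (c a b : A) :
  ile a b -> ile (c * a) (c * b).
Proof. by rewrite /ile -mulrDr => ->. Qed.

(** * Linear forms constant on bend classes *)

Section BendInvariant.
Context {K : fieldType} {A : comNzSemiRingType} {M : nmodType}.
(* Reflexivity of the canonical order. *)
Hypothesis addAA : forall a : A, a + a = a.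
Hypothesis addrI_M : right_injective (@GRing.add M).
Variable v : K -> A.
Hypothesis v_val : valuation v.
Hypothesis vN : forall x, v (- x) = v x.
Variable I : set (monoid_algebra K M).
Hypothesis I_ideal : ideal I.

(** Linear forms on K[M] vanishing on [I], given by their values on the
    monomials. *)
Definition annihilator (l : M -> K) : Prop := forall F, I F -> pairing F l = 0.

(** Translating [l] by [x] amounts to multiplying [I] by [chi^x]. *)
Lemma annihilator_shift l x :
  annihilator l -> annihilator (fun u => l (x + u)).
Proof.
have [_ _ IM] := I_ideal; move=> Il F IF.
by rewrite -[LHS]mul1r -pairing_shift Il //; apply: IM.
Qed.

Definition trop_pairing (a : monoid_algebra A M) (l : M -> K) : A :=
  pairing a (fun u => v (l u)).

Definition pairing_congruence (a b : monoid_algebra A M) : Prop :=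
  forall l, annihilator l -> trop_pairing a l = trop_pairing b l.

Lemma trop_pairingM (a b : monoid_algebra A M) l :
  trop_pairing (a * b) l =
  \sum_(x <- finsupp a) a x * trop_pairing b (fun u => l (x + u)).
Proof.
rewrite /trop_pairing {1}[a]mterm_sumE mulr_suml pairing_sum.
by apply: eq_bigr => x _; rewrite pairing_shift.
Qed.

(** A tropicalized form is only S-linear; compatibility with products holds for
    all annihilating forms together, because translates of such forms are
    again among them. *)
Lemma pairing_congruenceP : is_congruence pairing_congruence.
Proof.
have mulE a b b' : pairing_congruence b b' ->
    pairing_congruence (a * b) (a * b').
  move=> bb l Il; rewrite !trop_pairingM; apply: eq_bigr => x _.
  by rewrite bb //; apply: annihilator_shift.
split.
- by [].
- by move=> a b ab l Il; rewrite ab.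
- by move=> a b c ab bc l Il; rewrite ab // bc.
- by move=> a a' b b' aa bb l Il; rewrite /trop_pairing !pairingD; congr +%R;
    [apply: aa|apply: bb].
- move=> a a' b b' aa bb l Il; rewrite (mulE a b b') //.
  by rewrite mulrC (mulE b' a a') // mulrC.
Qed.

(** Tropical vanishing of [a] at [v \o l]: no single term of the pairing
    exceeds the sum of the other terms. *)
Definition vanishes (a : monoid_algebra A M) (l : M -> K) : Prop :=
  forall i, ile (a i * v (l i)) (trop_pairing (delete_term a i) l).

Lemma ile_valuation_sum (T : Type) (r : seq T) (x : T -> K) :
  ile (v (\sum_(i <- r) x i)) (\sum_(i <- r) v (x i)).
Proof.
have [v0 _ _ vD] := v_val.
apply: (big_rec2 (fun a b => ile (v a) b)); first
  by rewrite (v0 0).2 // /ile addr0.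
move=> i b a _ ab; apply: ile_trans (vD _ _) _.
by apply: ile_add => //; apply: addAA.
Qed.

Lemma tropE (F : monoid_algebra K M) u : trop v F u = v (F u).
Proof.
have [v0 _ _ _] := v_val; rewrite fsfunE; case: finsuppP => // _.
by rewrite (v0 0).2.
Qed.

(** In a vanishing sum every term is minus the sum of the others, and [v]
    ignores signs. *)
Lemma trop_vanishes (F : monoid_algebra K M) l :
  pairing F l = 0 -> vanishes (trop v F) l.
Proof.
have [v0 vM _ _] := v_val; move=> Fl i.
have := Fl; rewrite -{1}(delete_termK F i) pairingD pairing_mterm.
move/eqP; rewrite addr_eq0 => /eqP Fli.
rewrite tropE -vM Fli vN /pairing.
have dF :
  (finsupp (delete_term (trop v F) i) `<=` finsupp (delete_term F i))%fset.
  apply/fsubsetP => u; rewrite !mem_finsupp !delete_termE.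
  case: (u == i); rewrite ?eqxx // tropE; apply: contraNN => /eqP ->.
  by rewrite (v0 0).2.
rewrite /trop_pairing (pairing_widen _ dF).
apply: ile_trans (ile_valuation_sum _ _) _; apply: ile_sum => u _.
rewrite vM !delete_termE tropE; case: (u == i); last exact: addAA.
by rewrite (v0 0).2 //; exact: addAA.
Qed.

(** This reduces the bend relations of the ideal [trop I] to those of its
    generators.  Closure under multiplication is checked on terms, for which
    cancellation in [M] matches the terms of [c chi^x * b] with those of [b]. *)
Lemma vanishing_ideal :
  ideal [set a | forall l, annihilator l -> vanishes a l]%classic.
Proof.
have J0 l : vanishes 0 l.
  move=> i; rewrite Defs.coef0 mul0r; exact: add0r.
have JD a b l : vanishes a l -> vanishes b l -> vanishes (a + b) l.
  move=> al bl i; rewrite Defs.coefD mulrDl delete_termD /trop_pairing pairingD.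
  by apply: ile_add; [apply: al|apply: bl].
split=> [l _|a b Ja Jb l Il|a b Jb l Il].
- exact: J0.
- by apply: JD; [apply: Ja|apply: Jb].
rewrite [a]mterm_sumE mulr_suml.
apply: (big_ind (vanishes^~ l)) => [|b1 b2|x _]; [exact: J0|exact: JD|].
move=> i; have [[u ->]|nu] := pselect (exists u, i = x + u).
  rewrite delete_term_shift // coef_shift // /trop_pairing pairing_shift.
  rewrite -mulrA; apply: ile_mull.
  by apply: (Jb (fun u => l (x + u))); apply: annihilator_shift.
rewrite (_ : (mterm (a x) x * b) i = 0); first by rewrite mul0r; exact: add0r.
rewrite [b]mterm_sumE mulr_sumr Defs.coef_sum big1 // => u _.
by rewrite mulr_mterm mtermE; case: eqP => // iu; case: nu; exists u.
Qed.

(** It is enough to check the generating bend relations, where the deleted term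
    is absorbed by the others because it does not exceed their sum. *)
Lemma bend_pairing a b l :
  bend (trop_ideal v I) a b -> annihilator l ->
  trop_pairing a l = trop_pairing b l.
Proof.
move=> ab; apply: (ab pairing_congruence pairing_congruenceP).
move=> {ab} _ _ [c [i [Jc _ -> ->]]] {}l Il.
rewrite -{1}(delete_termK c i) /trop_pairing pairingD pairing_mterm.
apply: (Jc _ vanishing_ideal) => //= _ [F IF <-] k Ik.
by apply: trop_vanishes; apply: Ik.
Qed.

End BendInvariant.

(** * Sets of monomials containing no circuit *)

Lemma circuit_in_support (K : fieldType) (M : nmodType)
    (I : set (monoid_algebra K M)) F :
  I F -> F <> 0 -> exists2 C, circuit I C & (C `<=` finsupp F)%fset.
Proof.
have [n] := ubnP #|` finsupp F|; elim: n F => // n IHn F Fn IF F0.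
have [Fmin|] := pselect (forall G, I G -> G <> 0 ->
    (finsupp G `<=` finsupp F)%fset -> finsupp G = finsupp F).
  by exists (finsupp F) => //; exists F.
move=> /existsNP[G] /not_implyP[IG] /not_implyP[G0] /not_implyP[GF] /eqP GnF.
have [|C IC CG] := IHn G _ IG G0; last
  by exists C => //; apply: fsubset_trans GF.
apply: leq_trans _ (Fn : (#|` finsupp F| <= n)%N).
by apply: fproper_ltn_card; rewrite fproperEneq GnF.
Qed.

(** Modulo [I] the monomials in [m |` U] are linearly independent, since a
    dependency would be a nonzero element of [I] with support in [m |` U]. *)
Lemma exists_annihilator (K : fieldType) (M : nmodType)
    (I : set (monoid_algebra K M)) (I_ideal : ideal I) (U : {fset M}) (m : M) :
  m \notin U -> (forall C, circuit I C -> ~~ (C `<=` m |` U)%fset) ->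
  exists l, [/\ annihilator I l, l m = 1 & forall u, u \in U -> l u = 0].
Proof.
have [I0 ID IM] := I_ideal; move=> mU indep.
(* The subspace spanned by [I] and the monomials in [U]. *)
pose W : set (monoid_algebra K M) :=
  [set F | exists2 G, I G & forall u, u \notin U -> F u = G u]%classic.
have IW F : I F -> W F by move=> IF; exists F.
have [| | |L [Llin Lm LW]] := @scalar_separation K _ W (monomial K m).
- exact: IW.
- move=> c F1 F2 [G1 IG1 FG1] [G2 IG2 FG2]; exists (c *: G1 + G2).
    by apply: ID => //; apply: IM.
  by move=> u uU; rewrite !Defs.coefD !coefZ FG1 // FG2.
- move=> [G IG mG].
  have G0 : G <> 0.
    move=> G0; move: (mG m mU); rewrite G0 mtermE eqxx Defs.coef0; apply/eqP.
    exact: oner_neq0.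
  have [C IC CG] := circuit_in_support IG G0.
  move: (indep C IC); rewrite (fsubset_trans CG) //.
  apply/fsubsetP => u; rewrite mem_finsupp !inE; apply: contraR.
  by rewrite negb_or => /andP[um uU]; rewrite -mG // mtermE (negPf um).
exists (fun u => L (monomial K u)); split=> //; last first.
  move=> u uU; apply: LW; exists 0 => // x xU; rewrite mtermE Defs.coef0.
  by case: eqP => // xu; rewrite xu uU in xU.
have L0 : L 0 = 0 by apply: LW; apply: IW.
have LD F G : L (F + G) = L F + L G by rewrite -[F]scale1r Llin scale1r mul1r.
have LZ c F : L (c *: F) = c * L F by rewrite -[c *: F]addr0 Llin L0 addr0.
move=> F IF; rewrite -[RHS](LW F (IW F IF)) [in RHS](mterm_sumE F).
rewrite (big_morph L LD L0); apply: eq_bigr => u _.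
rewrite -LZ; congr (L _).
by rewrite ma_scaleE mulr_mterm mulr1 add0r.
Qed.

(** * The missing-monomial construction *)

(** Termwise [m f_i <= f_(j_i) h_i <= f h_i], so that [f h] absorbs [m f]. *)
Lemma missing_monomial_mul {A : comNzSemiRingType} {M : nmodType}
    (addAA : forall a : A, a + a = a) (f g h : monoid_algebra A M) m :
  missing_monomial f m g h -> f * g = f * h.
Proof.
move=> [j [t [ft hE ->]]].
rewrite mulrDr addrC -[RHS]/(f * h) mulrC {1}[f]mterm_sumE.
rewrite mulr_sumr hE mulr_sumr.
apply: ile_sum => u uf; have [_ _ _ le_u] := ft u uf.
apply: ile_trans le_u _; rewrite mulrC [f * _]mulrC; apply: ile_mull.
apply/fsfunP => x; rewrite Defs.coefD mtermE; case: eqP => [->|_].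
  exact: addAA.
exact: add0r.
Qed.

(** If the term [h_u] had monomial [m], then comparing the monomials of
    [m f_u <= f_(j u) h_u] would give [j u = u]. *)
Lemma missing_monomial_coef {A : comNzSemiRingType} {M : nmodType}
    (addIr_M : left_injective (@GRing.add M)) (f g h : monoid_algebra A M) m :
  missing_monomial f m g h -> h m = 0.
Proof.
move=> [j [t [ft -> _]]]; rewrite Defs.coef_sum big1_seq // => u /andP[_ uf].
have [_ ju [a [w [_ ->]]] le_u] := ft u uf.
rewrite mtermE; case: eqP => // mw.
move: le_u => /fsfunP/(_ (m + u)); rewrite !mulr_mterm Defs.coefD.
rewrite !mtermE eqxx mul1r.
case: eqP => [|_].
  by rewrite mw addrC => /addIr_M /esym.
by rewrite addr0 => fu; rewrite mem_finsupp fu eqxx in uf.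
Qed.

(** * Valuations in subsemirings of the tropical semifield *)

Lemma tropical_idem (R : realType) (a : tropical R) : a + a = a.
Proof. by case: a => [//|a]; congr tfin; rewrite maxxx. Qed.

Lemma subsemiring_idem (R : realType) (S : semiringClosed (tropical R))
    (a : subsemiring S) : a + a = a.
Proof. by apply: val_inj; rewrite /= tropical_idem. Qed.

Lemma tropical_sqrt1 (R : realType) (a : tropical R) : a * a = 1 -> a = 1.
Proof.
case: a => [//|a] [] /eqP; rewrite -mulr2n mulrn_eq0 /= => /eqP ->.
by [].
Qed.

(** The square of [v (-1)] is 1, and addition of reals has no 2-torsion. *)
Lemma valuationN (R : realType) (S : semiringClosed (tropical R))
    (K : fieldType) (v : K -> subsemiring S) :
  valuation v -> forall x, v (- x) = v x.
Proof.
move=> [_ vM v1 _] x; rewrite -mulN1r vM (_ : v (-1) = 1) ?mul1r //.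
apply: val_inj; apply: tropical_sqrt1.
have vNN : v (-1) * v (-1) = 1 by rewrite -vM mulrNN mulr1.
exact: (congr1 val vNN).
Qed.

Lemma toric_addIr (R : realType) (M : zmodType) (sigma : set {additive M -> R}) :
  left_injective (@GRing.add (toric_monoid sigma)).
Proof.
move=> x y z /(congr1 val) /= yz; apply: val_inj.
exact: (@addIr _ (val x)).
Qed.

(** * Non-cancellativity *)

Theorem corollaryA4 (R : realType) (S : semiringClosed (tropical R))
    (S_semifield : semifield (subsemiring S))
    (K : fieldType) (v : K -> subsemiring S) (v_val : valuation v)
    (M : zmodType) (M_free : fg_free_abelian M)
    (sigma : set {additive M -> R})
    (sigma_rational : rational_polyhedral_cone sigma)
    (sigma_strongly_convex : strongly_convex sigma)
    (I : set (monoid_algebra K (toric_monoid sigma))) (I_ideal : ideal I)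
    (f : monoid_algebra (subsemiring S) (toric_monoid sigma)) :
  (exists (m : toric_monoid sigma)
      (g h : monoid_algebra (subsemiring S) (toric_monoid sigma)),
    missing_monomial f m g h /\
    forall C, circuit I C -> ~~ (C `<=` finsupp g)%fset) ->
  ~ cancellative (\pi_(cquot (bend (trop_ideal v I))) f).
Proof.
have addIr_M := @toric_addIr R M sigma.
have addrI_M : right_injective (@GRing.add (toric_monoid sigma)).
  by move=> x y z; rewrite ![x + _]addrC => /addIr_M.
have [v0 _ v1 _] := v_val.
move=> [m [g [h [fgh indep]]]] [_ f_lreg].
have fg_fh := missing_monomial_mul (@subsemiring_idem R S) fgh.
have hm := missing_monomial_coef addIr_M fgh.
have gE : g = h + monomial _ m by case: fgh => j [t []].
have gh : bend (trop_ideal v I) g h.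
  apply/asboolP/cquotP/f_lreg.
  have := congr1 (\pi_(cquot (bend (trop_ideal v I)))) fg_fh.
  by rewrite !pi_cquot_mul.
have [||l [Il lm lh]] := @exists_annihilator _ _ I I_ideal (finsupp h) m.
- by rewrite mem_finsupp hm eqxx.
- move=> C IC; apply: contraNN (indep C IC) => Cmh.
  apply: (fsubset_trans Cmh); apply/fsubsetP => u.
  rewrite in_fset1U !mem_finsupp gE Defs.coefD mtermE.
  have [->|_] := eqVneq u m; first by rewrite hm add0r oner_neq0.
  by rewrite addr0.
have trop_h : trop_pairing v h l = 0.
  rewrite /trop_pairing /pairing big1_seq // => u /andP[_ uh].
  by rewrite lh // (v0 0).2 // mulr0.
have := bend_pairing (@subsemiring_idem R S) addrI_M v_val (valuationN v_val)
  I_ideal gh Il.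
rewrite gE {1}/trop_pairing pairingD pairing_mterm.
rewrite -[pairing h _]/(trop_pairing v h l).
by rewrite trop_h add0r lm v1 mulr1; apply/eqP; apply: oner_neq0.
Qed.
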